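(* Let $K$ be a field of characteristic zero and let $M$ be a holonomic left module over the Weyl algebra $A_n(K)$. Then $H^i(\partial_1,\ldots,\partial_n;M)=0$ for all $i<n-\dim M$.
   Context: $A_n(K)=K\langle X_1,\ldots,X_n,\partial_1,\ldots,\partial_n\rangle$, containing $R=K[X_1,\ldots,X_n]$. $\dim M$ denotes the dimension of the support of $M$ regarded as an $R$-module (with $\dim 0=-\infty$). $H^i(\partial_1,\ldots,\partial_n;M)$ is the $i$-th cohomology of the De Rham complex of $M$, i.e. of the Koszul cochain complex of $M$ with respect to the commuting $K$-linear maps $\partial_1,\ldots,\partial_n$ (so $H^0$ is the common kernel and $H^n=M/\sum_j\partial_jM$). *)

(* Defs.v *)
From HB Require Import structures.
From mathcomp Require Import all_boot all_order all_algebra.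
From mathcomp Require Import mpoly.
Set Implicit Arguments. Unset Strict Implicit. Unset Printing Implicit Defensive.
Import Order.TTheory GRing.Theory.
Local Open Scope ring_scope.

(* A left A_n(K)-module is a K-vector space M together with K-linear
   operators X_1..X_n, d_1..d_n satisfying the defining relations of the
   Weyl algebra A_n(K) = K<X_1..X_n,d_1..d_n>. *)
Definition weyl_module (K : fieldType) (n : nat) (M : lmodType K)
  (X D : 'I_n -> {linear M -> M}) : Prop :=
  [/\ forall i j m, X i (X j m) = X j (X i m),
      forall i j m, D i (D j m) = D j (D i m)
    & forall i j m, D i (X j m) - X j (D i m) = (i == j)%:R *: m].

Definition Xmon (K : fieldType) (n : nat) (M : lmodType K)
  (X : 'I_n -> {linear M -> M}) (a : 'X_{1..n}) (m : M) : M :=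
  foldr (fun i acc => iter (a i) (X i) acc) m (enum 'I_n).

Definition polact (K : fieldType) (n : nat) (M : lmodType K)
  (X : 'I_n -> {linear M -> M}) (p : {mpoly K[n]}) (m : M) : M :=
  \sum_(a <- msupp p) p@_a *: Xmon X a m.

(* Holonomic: M is finitely generated, by v_1..v_r, and the Bernstein
   filtration B_k V = span{ X^a d^b v_j : |a|+|b| <= k } has
   dim_K B_k V <= C (k+1)^n for all k (i.e. d(M) <= n, which by
   Bernstein's inequality means M = 0 or d(M) = n). *)
Definition holonomic (K : fieldType) (n : nat) (M : lmodType K)
  (X D : 'I_n -> {linear M -> M}) : Prop :=
  exists (r : nat) (v : 'I_r -> M) (C : nat),
    (forall m : M, exists s : seq (('X_{1..n} * 'X_{1..n}) * ('I_r * K)),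
        m = \sum_(t <- s) t.2.2 *: Xmon X t.1.1 (Xmon D t.1.2 (v t.2.1)))
    /\ (forall k : nat, exists w : 'I_(C * k.+1 ^ n) -> M,
          forall (a b : 'X_{1..n}) (j : 'I_r), (mdeg a + mdeg b <= k)%N ->
            exists c : 'I_(C * k.+1 ^ n) -> K,
              Xmon X a (Xmon D b (v j)) = \sum_l c l *: w l).

Definition prime_ideal (K : fieldType) (n : nat) (P : {mpoly K[n]} -> Prop) :=
  [/\ P 0, forall p q, P p -> P q -> P (p + q),
      forall p q, P q -> P (p * q), ~ P 1
    & forall p q, P (p * q) -> P p \/ P q].

(* P is in the support of M as an R-module, i.e. the localization M_P is
   nonzero: some m/1 <> 0, i.e. no s outside P kills m. *)
Definition in_support (K : fieldType) (n : nat) (M : lmodType K)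
  (X : 'I_n -> {linear M -> M}) (P : {mpoly K[n]} -> Prop) : Prop :=
  exists m : M, forall s, ~ P s -> polact X s m <> 0.

Definition support_chain (K : fieldType) (n : nat) (M : lmodType K)
  (X : 'I_n -> {linear M -> M}) (L : nat) (c : nat -> {mpoly K[n]} -> Prop) :=
  (forall j, (j <= L)%N -> prime_ideal (c j) /\ in_support X (c j)) /\
  (forall j, (j < L)%N -> (forall p, c j p -> c j.+1 p) /\
                          exists p, c j.+1 p /\ ~ c j p).

(* "dim M + i < n", where dim M = sup of lengths of chains in Supp M
   (= -oo when M = 0) *)
Definition supp_dim_plus_lt (K : fieldType) (n : nat) (M : lmodType K)
  (X : 'I_n -> {linear M -> M}) (i : nat) : Prop :=
  forall L c, support_chain X L c -> (L + i < n)%N.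

(* De Rham (Koszul cochain) complex: an i-cochain is a family of elements of
   M indexed by the i-subsets of {1..n} (values on other subsets ignored). *)
Definition dR (K : fieldType) (n : nat) (M : lmodType K)
  (D : 'I_n -> {linear M -> M}) (w : {set 'I_n} -> M) (T : {set 'I_n}) : M :=
  \sum_(j in T) (-1) ^+ #|[set k in T | (k < j)%N]| *: D j (w (T :\ j)).

Definition deRham_vanish (K : fieldType) (n : nat) (M : lmodType K)
  (D : 'I_n -> {linear M -> M}) (i : nat) : Prop :=
  forall w : {set 'I_n} -> M,
    (forall T : {set 'I_n}, #|T| = i.+1 -> dR D w T = 0) ->
    exists u : {set 'I_n} -> M, forall T : {set 'I_n}, #|T| = i -> w T = dR D u T.

(* Main.v *)
Require Import Defs.
From HB Require Import structures.
From mathcomp Require Import all_boot all_order all_algebra.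
From mathcomp Require Import mpoly ssrcomplements ring.
From mathcomp Require boolp classical_sets.
Set Implicit Arguments. Unset Strict Implicit. Unset Printing Implicit Defensive.
Import Order.TTheory GRing.Theory.
Local Open Scope ring_scope.

(** Every m in M is killed by a power of each element of I, the common
    annihilator in R = K[X_1..X_n] of a finite generating set, and the support
    of M contains every prime over I.

    Write y_l = sum_j l_j D_j for l in K^n.  Since y_l acts as zero on Koszul
    cohomology, H^i = 0 for i < s as soon as some y_(l_1), ..., y_(l_s) is an
    M-regular sequence; this replaces any change of coordinates in the complex.
    For regularity, suppose that f in I is a nonzero polynomial in linear forms
    killed by l_1, ..., l_(k-1).  Choose l_k along which the top form of f does
    not vanish: if y_(l_k) m lies in
    N = sum_(j<k) y_(l_j) M and f^e m = 0, then differentiating f^e m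
    repeatedly along l_k leaves a nonzero constant times m, so m is in N.

    The construction stops only when I contains no nonzero polynomial in the
    linear forms killed by l_1, ..., l_s.  As each f is monic along its l_k up
    to a constant, R/I is then finite over the polynomial ring A in these
    forms, and A embeds in R/I.  Hence R/I has a chain of primes of length
    n - s: take a prime P over I maximal with respect to meeting A in 0,
    adjoin to P one of the n - s forms, and repeat. *)

(** * Regular sequences and Koszul cohomology *)

Section Koszul.
Variables (K : fieldType) (n : nat) (M : lmodType K).
Variable D : 'I_n -> {linear M -> M}.
Hypothesis two_neq0 : (2 : K) != 0.
Hypothesis DC : forall i j m, D i (D j m) = D j (D i m).

Implicit Types (T : {set 'I_n}) (w : {set 'I_n} -> M) (N : M -> Prop).

Definition dirD (l : 'I_n -> K) (m : M) : M := \sum_j l j *: D j m.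

(** Interior product with the constant vector [l]; the sign records the position of [j] in
    [j |: T]. *)
Definition contract (l : 'I_n -> K) w T : M :=
  \sum_(j | j \notin T)
     (-1) ^+ #|[set k in T | (k < j)%N]| *: (l j *: w (j |: T)).

Lemma card_below_setU1 T (j k : 'I_n) : k \notin T ->
  #|[set x in k |: T | (x < j)%N]| = ((k < j) + #|[set x in T | (x < j)%N]|)%N.
Proof.
move=> kT; case: (boolP (k < j)%N) => kj.
  have -> : [set x in k |: T | (x < j)%N] = k |: [set x in T | (x < j)%N].
    by apply/setP=> x; rewrite !inE; case: eqVneq => // ->; rewrite kj.
  by rewrite cardsU1 inE (negPf kT).
apply: eq_card => x; rewrite !inE.
by case: eqVneq => // ->; rewrite (negPf kj) (negPf kT).
Qed.

Lemma card_below_setD1 T (j k : 'I_n) : k \in T ->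
  #|[set x in T | (x < j)%N]| = ((k < j) + #|[set x in T :\ k | (x < j)%N]|)%N.
Proof. by move=> kT; rewrite -card_below_setU1 ?setD11 // setD1K. Qed.

Lemma sign_ltn_anti (j k : 'I_n) : j != k ->
  (-1) ^+ (j < k)%N = - (-1) ^+ (k < j)%N :> K.
Proof. by rewrite -val_eqE neq_ltn; case: ltngtP; rewrite ?expr0 ?expr1 ?opprK. Qed.

(** The double sum is antisymmetric in the two removed indices, hence equal to its own negative;
    [two_neq0] then makes it 0. *)
Lemma dR_dR w T : dR D (dR D w) T = 0.
Proof.
pose t (j k : 'I_n) : M := (-1) ^+ #|[set x in T | (x < j)%N]| *:
  ((-1) ^+ #|[set x in T :\ j | (x < k)%N]| *: D j (D k (w (T :\ j :\ k)))).
have tA j k : j \in T -> k \in T -> j != k -> t k j = - t j k.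
  move=> jT kT jk; rewrite /t DC !setDDl [[set k] :|: _]setUC.
  rewrite (card_below_setD1 j kT) (card_below_setD1 k jT) !scalerA -scaleNr.
  by rewrite !exprD (sign_ltn_anti jk); congr (_ *: _); ring.
have -> : dR D (dR D w) T = \sum_(j in T) \sum_(k in T | k != j) t j k.
  apply: eq_bigr => j jT; rewrite [dR D w _]/dR linear_sum scaler_sumr /=.
  by apply: eq_big => [k|k _]; rewrite ?inE 1?andbC // linearZ.
set S := \sum_(j in T) _.
have SN : S = - S.
  rewrite {1}/S (exchange_big_dep (mem T)) /=; last by move=> j k _ /andP[].
  rewrite -sumrN; apply: eq_bigr => k kT; rewrite -sumrN.
  apply: eq_big => [j|j /andP[jT /andP[_ kj]]]; first by rewrite kT eq_sym.
  by rewrite tA // eq_sym.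
have /eqP : 2 *: S = 0 by rewrite scaler_nat mulr2n {1}SN addNr.
by rewrite scaler_eq0 (negPf two_neq0) => /eqP.
Qed.

(* Cartan's formula: the class of [dirD l] acts as zero on cohomology. *)
Lemma dR_contract l w T :
  dR D (contract l w) T + contract l (dR D w) T = dirD l (w T).
Proof.
(* The off-diagonal terms [a j k] occur in the two compositions with opposite signs; the diagonal
   ones give the parts of [dirD l] with [j] inside and outside [T]. *)
pose a (j k : 'I_n) : M := (-1) ^+ #|[set x in T | (x < j)%N]| *:
  ((-1) ^+ #|[set x in T :\ j | (x < k)%N]| *: (l k *: D j (w (k |: T :\ j)))).
have -> : dR D (contract l w) T =
    \sum_(j in T) (l j *: D j (w T) + \sum_(k | k \notin T) a j k).
  apply: eq_bigr => j jT; rewrite /contract (bigD1 j) /=; last by rewrite setD11.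
  rewrite linearD scalerDr; congr (_ + _).
    rewrite !linearZ /= setD1K // (card_below_setD1 j jT) ltnn add0n !scalerA.
    by rewrite mulrAC -expr2 sqrr_sign mul1r.
  rewrite linear_sum scaler_sumr; apply: eq_big => [k|k _];
    last by congr (_ *: _); rewrite linearZ /= linearZ.
  by rewrite !inE; case: eqVneq => [->|]; rewrite ?jT ?andbT.
have -> : contract l (dR D w) T =
    \sum_(k | k \notin T) (l k *: D k (w T) - \sum_(j in T) a j k).
  apply: eq_bigr => k kT; rewrite /dR (bigD1 k) /=; last by rewrite setU11.
  rewrite !scalerDr; congr (_ + _).
    rewrite setU1K // card_below_setU1 // ltnn add0n !scalerA.
    by rewrite mulrAC -expr2 sqrr_sign mul1r.
  rewrite -sumrN !scaler_sumr; apply: eq_big => [j|j].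
    by rewrite !inE; case: eqVneq => [->|]; rewrite ?(negPf kT) ?andbT.
  rewrite !inE => /andP[jkT jk].
  have jT : j \in T by case/orP: jkT => // /eqP e; rewrite e eqxx in jk.
  have -> : (k |: T) :\ j = k |: T :\ j.
    apply/setP=> x; rewrite !inE.
    by do 2!case: eqVneq => //= ?; subst; rewrite eqxx in jk.
  rewrite /a card_below_setU1 // (card_below_setD1 k jT) -scaleNr.
  rewrite !scalerA !exprD (sign_ltn_anti jk); congr (_ *: _).
  by rewrite -[RHS]mul1r -[X in _ = X * _](sqrr_sign K (k < j)%N); ring.
rewrite !big_split /= sumrN addrACA [X in _ + (X - _)]exchange_big subrr addr0.
by rewrite /dirD [RHS](bigID (mem T)).
Qed.

Definition submodule N : Prop :=
  [/\ N 0, forall a b, N a -> N b -> N (a + b) & forall c a, N a -> N (c *: a)].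

Definition D_stable N : Prop := forall j m, N m -> N (D j m).

Definition add_image (l : 'I_n -> K) N (m : M) : Prop :=
  exists a z, N a /\ m = a + dirD l z.

(** Existence of a regular sequence of [s] directions on M/N; enlarging [N] by an image replaces
    passing to a quotient module. *)
Fixpoint regular (s : nat) N : Prop :=
  if s is s'.+1 then
    exists l, (forall m, N (dirD l m) -> N m) /\ regular s' (add_image l N)
  else True.

Lemma submodule_sum N (I : Type) (r : seq I) (P : pred I) (F : I -> M) :
  submodule N -> (forall i, P i -> N (F i)) -> N (\sum_(i <- r | P i) F i).
Proof. by case=> N0 ND _ NF; elim/big_ind: _. Qed.

Lemma submoduleN N m : submodule N -> N m -> N (- m).
Proof. by case=> _ _ NZ /(NZ (-1)); rewrite scaleN1r. Qed.

Lemma dirDD l a b : dirD l (a + b) = dirD l a + dirD l b.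
Proof. by rewrite -big_split; apply: eq_bigr => j _; rewrite linearD scalerDr. Qed.

Lemma dirDZ l c a : dirD l (c *: a) = c *: dirD l a.
Proof.
rewrite scaler_sumr; apply: eq_bigr => j _.
by rewrite linearZ !scalerA mulrC.
Qed.

Lemma D_dirD l j m : D j (dirD l m) = dirD l (D j m).
Proof. by rewrite linear_sum; apply: eq_bigr => k _; rewrite linearZ DC. Qed.

Lemma submodule_add_image l N : submodule N -> submodule (add_image l N).
Proof.
case=> N0 ND NZ; split.
- by exists 0, 0; rewrite /dirD big1 ?addr0 // => j _; rewrite linear0 scaler0.
- move=> _ _ [a [z [Na ->]]] [b [y [Nb ->]]]; exists (a + b), (z + y).
  by rewrite dirDD addrACA; split=> //; apply: ND.
- move=> c _ [a [z [Na ->]]]; exists (c *: a), (c *: z).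
  by rewrite dirDZ scalerDr; split=> //; apply: NZ.
Qed.

Lemma D_stable_add_image l N : D_stable N -> D_stable (add_image l N).
Proof.
move=> ND j _ [a [z [Na ->]]]; exists (D j a), (D j z).
by rewrite linearD D_dirD; split=> //; apply: ND.
Qed.

Lemma dR_stable N w T : submodule N -> D_stable N ->
  (forall j, j \in T -> N (w (T :\ j))) -> N (dR D w T).
Proof.
move=> sN dN Nw; apply: submodule_sum => // j jT.
by case: (sN) => _ _; apply; apply/dN/Nw.
Qed.

Lemma dRD w w' T : dR D (fun S => w S + w' S) T = dR D w T + dR D w' T.
Proof. by rewrite -big_split; apply: eq_bigr => j _; rewrite linearD scalerDr. Qed.

Lemma dRN w T : dR D (fun S => - w S) T = - dR D w T.
Proof. by rewrite -sumrN; apply: eq_bigr => j _; rewrite linearN scalerN. Qed.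

Lemma dR_dirD l w T : dR D (fun S => dirD l (w S)) T = dirD l (dR D w T).
Proof.
under [RHS]eq_bigr => k _ do rewrite linear_sum scaler_sumr.
rewrite exchange_big; apply: eq_bigr => j _; rewrite D_dirD scaler_sumr.
by apply: eq_bigr => k _; rewrite [in RHS]linearZ !scalerA mulrC.
Qed.

(** By Cartan's formula [contract l w] is a cocycle modulo [add_image l N], one degree lower. By
    induction it is [dR D u + dirD l z] modulo [N]; applying [dR] puts [dirD l (w - dR D z)] in [N],
    and [dirD l] is injective modulo [N]. *)
Lemma regular_deRham i N : submodule N -> D_stable N -> regular i.+1 N ->
  forall w, (forall T, #|T| = i.+1 -> N (dR D w T)) ->
  exists u, forall T, #|T| = i -> N (w T - dR D u T).
Proof.
elim: i N => [|i IH] N sN dN /= [l [lN reg]] w wN; case: (sN) => N0 ND NZ.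
  exists (fun=> 0) => T /eqP; rewrite cards_eq0 => /eqP ->.
  rewrite [dR _ _ _]/dR big_set0 subr0; apply: lN.
  apply: submodule_sum => // j _; apply: (NZ).
  have := NZ ((-1) ^+ #|[set k in [set j] | (k < j)%N]|) _ (wN _ (cards1 j)).
  by rewrite /dR big_set1 scalerA -expr2 sqrr_sign scale1r setDv.
have sN' := submodule_add_image l sN; have dN' := D_stable_add_image (l := l) dN.
have hdw T : #|T| = i.+1 -> N (contract l (dR D w) T).
  move=> cT; apply: submodule_sum => // j jT; do 2!apply: (NZ); apply: wN.
  by rewrite cardsU1 jT cT.
have /(IH _ sN' dN' reg) [u uP] : forall T, #|T| = i.+1 ->
    add_image l N (dR D (contract l w) T).
  move=> T cT; exists (- contract l (dR D w) T), (w T).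
  rewrite -dR_contract [RHS]addrC addrK; split=> //.
  by apply: submoduleN => //; apply: hdw.
have [z zP] : exists z : {set 'I_n} -> M, forall T, #|T| = i ->
    N (contract l w T - dR D u T - dirD l (z T)).
  apply: (fin_all_exists (P := fun T z => #|T| = i ->
    N (contract l w T - dR D u T - dirD l z))) => T.
  have [cT|/eqP ncT] := eqVneq #|T| i; last by exists 0.
  by have [a [y [Na e]]] := uP T cT; exists y => _; rewrite e addrK.
exists z => T cT; apply: lN.
have -> : dirD l (w T - dR D z T) =
   dR D (fun S => contract l w S - dR D u S - dirD l (z S)) T
   + contract l (dR D w) T.
  rewrite dRD dRN dRD dRN dR_dR oppr0 addr0 dR_dirD addrAC dR_contract.
  by rewrite -scaleN1r dirDD dirDZ scaleN1r.
apply: ND; last exact: hdw.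
apply: dR_stable => // j jT; apply: zP.
by move: cT; rewrite (cardsD1 j T) jT => -[].
Qed.

End Koszul.

(** * The action of polynomials on a Weyl module *)

Lemma mpoly_alg_ind (K : comNzRingType) (n : nat) (P : {mpoly K[n]} -> Prop) :
  (forall c, P c%:MP) -> (forall i, P 'X_i) ->
  (forall p q, P p -> P q -> P (p + q)) ->
  (forall p q, P p -> P q -> P (p * q)) -> forall p, P p.
Proof.
move=> PC PX PD PM; apply: mpolyind => [|c m p _ _ Pp]; first by rewrite -mpolyC0.
apply: PD => //; rewrite -mul_mpolyC; apply: (PM) => //.
rewrite mpolyXE_id; apply: big_ind => [||i _]; [by rewrite -mpolyC1 | exact: PM |].
by elim: (m i) => [|k IH]; rewrite ?expr0 -?mpolyC1 // exprS; apply: PM.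
Qed.

Section Action.
Variables (K : fieldType) (n : nat) (M : lmodType K).
Variable X : 'I_n -> {linear M -> M}.
Hypothesis XC : forall i j m, X i (X j m) = X j (X i m).

Lemma iterX_comm (f : M -> M) i k m : (forall m, f (X i m) = X i (f m)) ->
  f (iter k (X i) m) = iter k (X i) (f m).
Proof. by move=> fX; elim: k => //= k <-. Qed.

Lemma Xmon_linear a : linear (Xmon X a).
Proof.
move=> c x y; rewrite /Xmon; elim: (enum _) => //= i s ->.
by elim: (a i) => //= k ->; rewrite linearP.
Qed.

Lemma XmonD a b m : Xmon X (a + b)%MM m = Xmon X a (Xmon X b m).
Proof.
rewrite /Xmon; elim: (enum _) => //= i s ->; rewrite mnmDE iterD; congr iter.
rewrite -(@iterX_comm (foldr (fun i => iter (a i) (X i)) ^~ s)) // => {}m.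
by elim: s => //= k s ->; rewrite iterX_comm // => x; rewrite XC.
Qed.

Lemma XmonU i m : Xmon X U_(i)%MM m = X i m.
Proof.
rewrite /Xmon; have : i \in enum 'I_n by rewrite mem_enum.
have : uniq (enum 'I_n) by rewrite enum_uniq.
elim: (enum _) => //= j s IH /andP[js us]; rewrite in_cons mnm1E.
have [-> _ /=|_ /= /(IH us)->//] := eqVneq i j; congr (X j _).
elim: s js {IH us} => //= k s IH; rewrite in_cons negb_or mnm1E => /andP[jk /IH->].
by rewrite (negPf jk).
Qed.

Lemma Xmon0 m : Xmon X 0%MM m = m.
Proof. by rewrite /Xmon; elim: (enum _) => //= i s ->; rewrite mnm0E. Qed.

Lemma polact_widen k p m : (msize p <= k)%N ->
  polact X p m = \sum_(a : 'X_{1..n < k}) p@_a *: Xmon X a m.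
Proof.
move=> le_pk; rewrite /polact (big_mksub 'X_{1..n < k}) /=; first last.
  by move=> x /msize_mdeg_lt /leq_trans; apply.
  by rewrite msupp_uniq.
by rewrite big_rmcond //= => a /memN_msupp_eq0->; rewrite scale0r.
Qed.

Lemma polactD p q m : polact X (p + q) m = polact X p m + polact X q m.
Proof.
have [sp sq] := (leq_maxl (msize p) (msize q), leq_maxr (msize p) (msize q)).
rewrite !(@polact_widen (maxn (msize p) (msize q))) //; last exact: msizeD_le.
by rewrite -big_split; apply: eq_bigr => a _; rewrite mcoeffD scalerDl.
Qed.

Lemma polactZ c p m : polact X (c *: p) m = c *: polact X p m.
Proof.
rewrite !(@polact_widen (msize p)) ?msizeZ_le // scaler_sumr.
by apply: eq_bigr => a _; rewrite mcoeffZ scalerA.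
Qed.

Lemma polact0 m : polact X 0 m = 0.
Proof. by rewrite /polact msupp0 big_nil. Qed.

Lemma polactX a m : polact X 'X_[a] m = Xmon X a m.
Proof. by rewrite /polact msuppX big_seq1 mcoeffX eqxx scale1r. Qed.

Lemma polactXU i m : polact X 'X_i m = X i m.
Proof. by rewrite polactX XmonU. Qed.

Lemma polactC c m : polact X c%:MP m = c *: m.
Proof. by rewrite -[c%:MP]mulr1 mul_mpolyC polactZ -mpolyX0 polactX Xmon0. Qed.

Lemma polact_linear p : linear (polact X p).
Proof.
move=> c x y; rewrite /polact scaler_sumr -big_split; apply: eq_bigr => a _.
by rewrite Xmon_linear scalerDr !scalerA mulrC.
Qed.

Lemma polactDr p x y : polact X p (x + y) = polact X p x + polact X p y.
Proof. by have := polact_linear p 1 x y; rewrite !scale1r. Qed.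

Lemma polact0r p : polact X p 0 = 0.
Proof. by have := polact_linear p (-1) 0 0; rewrite scaler0 addr0 scaleN1r addNr. Qed.

Lemma polactZr p c x : polact X p (c *: x) = c *: polact X p x.
Proof. by have := polact_linear p c x 0; rewrite polact0r !addr0. Qed.

Lemma polactM p q m : polact X (p * q) m = polact X p (polact X q m).
Proof.
elim/mpolyind: p => [|c a p _ _ IHp]; first by rewrite mul0r !polact0.
rewrite mulrDl !polactD IHp -scalerAl !polactZ polactX; congr (_ *: _ + _).
elim/mpolyind: q {IHp} => [|d b q _ _ IHq].
  by rewrite mulr0 polact0 -polactX polact0r.
rewrite mulrDr !polactD IHq -scalerAr !polactZ -mpolyXD !polactX XmonD.
by rewrite -[Xmon X a (_ + _)]polactX polactDr polactZr !polactX.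
Qed.

Variable D : 'I_n -> {linear M -> M}.
Hypothesis DX : forall i j m, D i (X j m) - X j (D i m) = (i == j)%:R *: m.

Lemma D_polact i p m :
  D i (polact X p m) = polact X p (D i m) + polact X (mderiv i p) m.
Proof.
elim/mpoly_alg_ind: p m => [c|j|p q IHp IHq|p q IHp IHq] m.
- by rewrite mderivC polact0 addr0 !polactC linearZ.
- apply/eqP; rewrite addrC -subr_eq !polactXU DX mderivX mnm1E.
  rewrite polactZ; apply/eqP; have [->|ij] := eqVneq i j; last first.
    by rewrite !scale0r.
  by rewrite -{1}[U_(j)%MM]add0m addmK polactX Xmon0.
- by rewrite mderivD !polactD linearD IHp IHq addrACA.
- by rewrite mderivM polactD !polactM IHp IHq polactDr -addrA [X in _ + X]addrC.
Qed.

Definition dir_deriv (l : 'I_n -> K) (p : {mpoly K[n]}) : {mpoly K[n]} :=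
  \sum_j l j *: mderiv j p.

Lemma dirD_polact l p m :
  dirD D l (polact X p m) = polact X p (dirD D l m) + polact X (dir_deriv l p) m.
Proof.
have polact_sumr : polact X p (dirD D l m) = \sum_j l j *: polact X p (D j m).
  rewrite /dirD (big_morph _ (polactDr p) (polact0r p)).
  by apply: eq_bigr => j _; rewrite polactZr.
have polact_sum : polact X (dir_deriv l p) m = \sum_j l j *: polact X (mderiv j p) m.
  rewrite /dir_deriv (big_morph (fun q => polact X q m) (fun p q => polactD p q m) (polact0 m)).
  by apply: eq_bigr => j _; rewrite polactZ.
rewrite polact_sumr polact_sum -big_split; apply: eq_bigr => j _.
by rewrite D_polact scalerDr.
Qed.

End Action.

(** * Derivatives along a direction *)

Section CharZero.
Variables (K : fieldType) (n : nat).
Hypothesis K0 : [pchar K] =i pred0.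
Local Notation R := {mpoly K[n]}.

Lemma pchar0_natrS_neq0 k : (k.+1%:R : K) != 0.
Proof. by rewrite ((pcharf0P _).1 K0). Qed.

Lemma poly_vanish (q : {poly K}) : (forall t, q.[t] = 0) -> q = 0.
Proof.
move=> q0; apply/eqP/negPn/negP => qn0.
(* The naturals below [size q] are distinct in characteristic zero: one root too many. *)
pose rs : seq K := [seq k%:R | k <- iota 0 (size q)].
have rs0 : all (root q) rs by apply/allP => x _; apply/eqP/q0.
suff /(max_poly_roots qn0 rs0) : uniq rs by rewrite size_map size_iota ltnn.
rewrite map_inj_uniq ?iota_uniq // => a b /eqP.
wlog ab : a b / (a <= b)%N => [H|].
  by case: (leqP a b) => [/H|/ltnW ba] //; rewrite eq_sym => /(H _ _ ba).
rewrite eq_sym -subr_eq0 -natrB // ((pcharf0P _).1 K0) subn_eq0 => ba.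
by apply/eqP; rewrite eqn_leq ab.
Qed.

(** The line through [v] in the [i]-th coordinate direction; substituting it restricts a polynomial
    to that line. *)
Definition shift_poly (i : 'I_n) (v : 'I_n -> K) (j : 'I_n) : {poly K} :=
  (v j)%:P + (i == j)%:R *: 'X.

Lemma deriv_shift i v (p : R) :
  (mmap polyC (shift_poly i v) p)^`() = mmap polyC (shift_poly i v) (mderiv i p).
Proof.
elim/mpoly_alg_ind: p => [c|j|p q IHp IHq|p q IHp IHq].
- by rewrite mderivC mmap0 mmapC derivC.
- rewrite mmapX mmap1U /shift_poly derivD derivC derivZ derivX add0r mderivX mnm1E.
  rewrite mmapZ eq_sym; have [->|ij] := eqVneq i j; last by rewrite /= !mulr0n scale0r polyC0 mul0r.
  by rewrite -{1}[U_(j)%MM]add0m addmK mmapX mmap11 mulr1 scale1r.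
- by rewrite mderivD !mmapD derivD IHp IHq.
- by rewrite mderivM mmapD !rmorphM /= derivM IHp IHq.
Qed.

(** Induction on a degree bound. On coordinate lines [p] restricts to the zero polynomial, so its
    partial derivatives vanish everywhere and are zero by induction; in characteristic zero [p] is
    then constant. *)
Lemma mpoly_vanish (p : R) : (forall v, p.@[v] = 0) -> p = 0.
Proof.
have [k] : exists k, forall m, (k <= mdeg m)%N -> p@_m = 0.
  by exists (msize p) => m /msize_mdeg_ge /memN_msupp_eq0.
elim: k p => [|k IH] p pk pv; first by apply/mpolyP => m; rewrite mcoeff0 pk.
have dp i : mderiv i p = 0.
  apply: IH => [m km|v].
    by rewrite mcoeff_mderiv pk ?mul0rn // mdegD mdeg1 addn1.
  have ev (f : R) t : (mmap polyC (shift_poly i v) f).[t] =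
       f.@[fun j => v j + (i == j)%:R * t].
    elim/mpoly_alg_ind: f => [c|j|f g IHf IHg|f g IHf IHg].
    - by rewrite mmapC hornerC mevalC.
    - by rewrite mmapX mmap1U mevalXU !hornerE.
    - by rewrite mmapD hornerD IHf IHg mevalD.
    - by rewrite rmorphM /= hornerM IHf IHg mevalM.
  have := ev (mderiv i p) 0; rewrite -deriv_shift.
  rewrite (poly_vanish (q := mmap _ _ p)) => [|t]; last by rewrite ev.
  rewrite derivC horner0 => ->; apply: meval_eq => j.
  by rewrite mulr0 addr0.
have pm m : m != 0%MM -> p@_m = 0.
  move=> m0; have [i mi] : exists i, (0 < m i)%N.
    apply/existsP; apply: contraNT m0 => /existsPn m0.
    by apply/eqP/mnmP => i; rewrite mnm0E; apply/eqP; rewrite -leqn0 leqNgt.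
  have := mcoeff_mderiv i p (m - U_(i))%MM.
  rewrite dp mcoeff0 submK; last first.
    by apply/mnm_lepP => j; rewrite mnm1E; case: eqVneq => // <-.
  move/esym/eqP; rewrite -mulr_natr mulf_eq0 (negPf (pchar0_natrS_neq0 _)) orbF.
  by move/eqP.
have pC : p = (p@_0)%:MP.
  apply/mpolyP => m; rewrite mcoeffC; have [->|/pm->] := eqVneq m 0%MM.
    by rewrite mulr1.
  by rewrite mulr0.
by have := pv (fun=> 0); rewrite pC mevalC => ->.
Qed.

Implicit Types (l : 'I_n -> K) (p q : R).

Lemma dir_derivD l p q : dir_deriv l (p + q) = dir_deriv l p + dir_deriv l q.
Proof. by rewrite -big_split; apply: eq_bigr => j _; rewrite mderivD scalerDr. Qed.

Lemma dir_derivZ l c p : dir_deriv l (c *: p) = c *: dir_deriv l p.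
Proof.
rewrite scaler_sumr; apply: eq_bigr => j _.
by rewrite mderivZ !scalerA mulrC.
Qed.

Lemma dir_derivC l c : dir_deriv l c%:MP = 0.
Proof. by rewrite /dir_deriv big1 // => j _; rewrite mderivC scaler0. Qed.

Lemma dir_derivM l p q : dir_deriv l (p * q) = dir_deriv l p * q + p * dir_deriv l q.
Proof.
rewrite mulr_suml mulr_sumr -big_split; apply: eq_bigr => j _.
by rewrite mderivM scalerDr scalerAl scalerAr.
Qed.

Lemma dir_derivXU l i : dir_deriv l 'X_i = (l i)%:MP.
Proof.
rewrite /dir_deriv (bigD1 i) //= big1 ?addr0 => [|j ji]; rewrite mderivX mnm1E.
  by rewrite eqxx -{1}[U_(i)%MM]add0m addmK mpolyX0 scale1r -mul_mpolyC mulr1.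
by rewrite eq_sym (negPf ji) scale0r scaler0.
Qed.

Lemma iter_dir_derivD l k p q :
  iter k (dir_deriv l) (p + q) = iter k (dir_deriv l) p + iter k (dir_deriv l) q.
Proof. by elim: k => //= k ->; rewrite dir_derivD. Qed.

Lemma iter_dir_derivZ l k c p :
  iter k (dir_deriv l) (c *: p) = c *: iter k (dir_deriv l) p.
Proof. by elim: k => //= k ->; rewrite dir_derivZ. Qed.

Lemma iter_dir_deriv0 l k : iter k (dir_deriv l) 0 = 0.
Proof. by elim: k => //= k ->; rewrite -mpolyC0 dir_derivC. Qed.

(* Along direction [l], [p] has degree at most [d], with coefficient [c] in degree [d]. *)
Definition dir_lead l p d c := iter d (dir_deriv l) p = (d`!%:R * c)%:MP.

(** Induction on [d + e]: the two Leibniz terms bring factors [d + 1] and [e + 1], whose sum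
    [d + e + 2] completes the factorial. *)
Lemma dir_leadM l p q d e c c' : dir_lead l p d c -> dir_lead l q e c' ->
  dir_lead l (p * q) (d + e) (c * c').
Proof.
move: {2}(d + e)%N (erefl (d + e)%N) => s; rewrite /dir_lead.
elim: s d e c c' p q => [|s IH] [|d] [|e] c c' p q //.
- by move=> _; rewrite /= !fact0 !mul1r => -> ->; rewrite mpolyCM.
- move=> _; rewrite add0n fact0 mul1r => /= -> qe.
  by rewrite mul_mpolyC -iterS iter_dir_derivZ /= qe -mul_mpolyC -mpolyCM; congr (_%:MP); ring.
- move=> _; rewrite addn0 fact0 mul1r => pd /= ->.
  rewrite mulrC mul_mpolyC -iterS iter_dir_derivZ /= -iterS pd.
  by rewrite -mul_mpolyC -mpolyCM; congr (_%:MP); ring.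
move=> [s_eq] pd qe; rewrite addSn iterSr dir_derivM iter_dir_derivD.
rewrite (IH d e.+1 (d.+1%:R * c) c') -?iterSr //; last first.
  by rewrite pd factS natrM; congr (_%:MP); ring.
rewrite addnS -addSn (IH d.+1 e c (e.+1%:R * c')) -?iterSr //; last first.
- by rewrite qe factS natrM; congr (_%:MP); ring.
- by move: s_eq; rewrite addnS.
rewrite -mpolyCD; congr (_%:MP); rewrite [(d.+1 + e).+1`!]factS natrM.
by rewrite -addnS natrD; ring.
Qed.

Lemma dir_leadX l (m : 'X_{1..n}) : dir_lead l 'X_[m] (mdeg m) ('X_[m]).@[l].
Proof.
rewrite mevalX mpolyXE_id mdegE; elim/big_rec3: _ => [|i c d p _ H].
  by rewrite /dir_lead /= mulr1.
apply: dir_leadM => //; elim: (m i) => [|k IH]; first by rewrite /dir_lead /= mulr1.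
rewrite !exprS -add1n; apply: dir_leadM => //.
by rewrite /dir_lead /= dir_derivXU mul1r.
Qed.

Lemma dir_lead_lt l p d e c : dir_lead l p d c -> (d < e)%N ->
  iter e (dir_deriv l) p = 0.
Proof.
move=> pd; elim: e => // e IH; rewrite ltnS leq_eqVlt => /orP[/eqP<- /=|/IH /= ->].
  by rewrite pd dir_derivC.
by rewrite -mpolyC0 dir_derivC.
Qed.

Lemma dir_leadXn l p d c k : dir_lead l p d c -> dir_lead l (p ^+ k) (d * k) (c ^+ k).
Proof.
move=> pd; elim: k => [|k IH]; first by rewrite muln0 /dir_lead /= mulr1.
by rewrite mulnS !exprS; apply: dir_leadM.
Qed.

(** Take the top homogeneous part [h] and a point [l] where it does not vanish. Differentiating [d]
    times along [l] kills the monomials of lower degree and turns [h] into [d! h(l)]. *)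
Lemma exists_dir_lead p : p != 0 -> exists l d c, c != 0 /\ dir_lead l p d c.
Proof.
move=> p0; pose d := (msize p).-1.
pose h : R := \sum_(m <- msupp p | mdeg m == d) p@_m *: 'X_[m].
have h0 : h != 0.
  apply: contraNneq (p0) => h0.
  have /eqP := congr1 (mcoeff (mlead p)) h0; rewrite mcoeff0 raddf_sum /=.
  rewrite -big_filter (bigD1_seq (mlead p)) ?filter_uniq ?msupp_uniq //=; last first.
    rewrite mem_filter mlead_supp // andbT -eqSS mlead_deg //.
    by rewrite prednK // lt0n msize_poly_eq0.
  rewrite big1 ?addr0 => [|m mp]; rewrite mcoeffZ mcoeffX ?eqxx ?(negPf mp) ?mulr0 //.
  by rewrite mulr1 mleadc_eq0.
have [l hl] : exists l, h.@[l] != 0.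
  apply: boolp.contrapT => nl; move: h0; rewrite (mpoly_vanish (p := h)) ?eqxx // => l.
  by apply/eqP/negPn/negP => hl; apply: nl; exists l.
exists l, d, h.@[l]; split=> //; rewrite /dir_lead [p in LHS]mpolyE.
rewrite (big_morph _ (iter_dir_derivD l d) (iter_dir_deriv0 l d)).
rewrite /h !raddf_sum mulr_sumr raddf_sum /= [RHS]big_mkcond /=; apply: eq_big_seq => m mp.
rewrite iter_dir_derivZ; case: eqP => [<-|/eqP md].
  by rewrite (dir_leadX l m) mevalZ -mul_mpolyC -mpolyCM; congr (_%:MP); ring.
rewrite (dir_lead_lt (dir_leadX l m)) ?scaler0 // ltn_neqAle md /=.
by rewrite -ltnS /d prednK ?msize_mdeg_lt // lt0n msize_poly_eq0.
Qed.

End CharZero.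

(** * Polynomials in a space of linear forms *)

Section LinearSubalgebra.
Variables (K : fieldType) (n : nat).
Local Notation R := {mpoly K[n]}.
Implicit Types (l : 'I_n -> K) (p q : R) (W : 'M[K]_n) (w z : 'rV[K]_n).

Definition linform w : R := \sum_j w 0 j *: 'X_j.

Definition dot l w : K := \sum_j w 0 j * l j.

(** The row space of [W] stands for a space of linear forms; the kernel keeps those vanishing at
    [l], that is, with zero derivative along [l]. *)
Definition perp W l : 'M[K]_n := (W :&: kermx (\col_j l j))%MS.

(** The subalgebra K[W] of R, defined by generation so that no basis of [W] has to be chosen. *)
Inductive linalg W : R -> Prop :=
| linalgC c : linalg W c%:MP
| linalg_linform w : (w <= W)%MS -> linalg W (linform w)
| linalgD p q : linalg W p -> linalg W q -> linalg W (p + q)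
| linalgM p q : linalg W p -> linalg W q -> linalg W (p * q).

Lemma linformD w w' : linform (w + w') = linform w + linform w'.
Proof. by rewrite -big_split; apply: eq_bigr => j _; rewrite mxE scalerDl. Qed.

Lemma linformZ c w : linform (c *: w) = c *: linform w.
Proof. by rewrite scaler_sumr; apply: eq_bigr => j _; rewrite mxE scalerA. Qed.

Lemma linform_delta j : linform (delta_mx 0 j) = 'X_j.
Proof.
rewrite /linform (bigD1 j) //= mxE !eqxx scale1r big1 ?addr0 // => i ij.
by rewrite mxE (negPf ij) andbF scale0r.
Qed.

Lemma dir_deriv_linform l w : dir_deriv l (linform w) = (dot l w)%:MP.
Proof.
rewrite /linform (big_morph _ (dir_derivD l) (_ : _ = 0)); last first.
  by rewrite -mpolyC0 dir_derivC.
rewrite raddf_sum; apply: eq_bigr => j _.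
by rewrite dir_derivZ dir_derivXU -mul_mpolyC -mpolyCM.
Qed.

Lemma sub_perp W l w : (w <= perp W l)%MS = (w <= W)%MS && (dot l w == 0).
Proof.
rewrite sub_capmx; congr (_ && _).
have -> : (w <= kermx (\col_j l j))%MS = (w *m \col_j l j == 0).
  by apply/sub_kermxP/eqP.
have -> : w *m \col_j l j = (dot l w)%:M.
  apply/matrixP => i j; rewrite !ord1 !mxE eqxx mulr1n.
  by apply: eq_bigr => k _; rewrite mxE.
by rewrite -scalemx1 scaler_eq0 oner_eq0 orbF.
Qed.

Lemma rank_perp W l : (\rank W <= (\rank (perp W l)).+1)%N.
Proof.
rewrite -[X in (X <= _)%N](mxrank_mul_ker W (\col_j l j)).
exact: leq_add (rank_leq_col _) (leqnn _).
Qed.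

Lemma linalg1 W : linalg W 1.
Proof. by rewrite -mpolyC1; apply: linalgC. Qed.

Lemma linalg0 W : linalg W 0.
Proof. by rewrite -mpolyC0; apply: linalgC. Qed.

Lemma linalgN W p : linalg W p -> linalg W (- p).
Proof.
move=> Wp; rewrite -mulN1r -mpolyC1 -mpolyCN.
by apply: linalgM => //; apply: linalgC.
Qed.

Lemma linalgZ W c p : linalg W p -> linalg W (c *: p).
Proof. by move=> Wp; rewrite -mul_mpolyC; apply: linalgM => //; apply: linalgC. Qed.

Lemma linalg_sum W (I : Type) (r : seq I) (P : pred I) (F : I -> R) :
  (forall i, P i -> linalg W (F i)) -> linalg W (\sum_(i <- r | P i) F i).
Proof. by move=> WF; apply: big_ind => //; [apply: linalg0 | apply: linalgD]. Qed.

Lemma linalg_prod W (I : Type) (r : seq I) (P : pred I) (F : I -> R) :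
  (forall i, P i -> linalg W (F i)) -> linalg W (\prod_(i <- r | P i) F i).
Proof. by move=> WF; apply: big_ind => //; [apply: linalg1 | apply: linalgM]. Qed.

Lemma linalg_det W N (A : 'M[R]_N) : (forall i j, linalg W (A i j)) -> linalg W (\det A).
Proof.
move=> WA; apply: linalg_sum => s _; apply: linalgM; last exact: linalg_prod.
by case: (perm.odd_perm s); rewrite ?expr1 ?expr0; [apply: linalgN|]; apply: linalg1.
Qed.

Lemma linalgT p : linalg 1%:M p.
Proof.
elim/mpoly_alg_ind: p => [c|i|p q|p q];
  [exact: linalgC| |exact: linalgD|exact: linalgM].
by rewrite -linform_delta; apply: linalg_linform; apply: submx1.
Qed.

Lemma linalg_sub W W' p : (W <= W')%MS -> linalg W p -> linalg W' p.
Proof.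
move=> WW'; elim=> [c|w wW|? ? _ ? _|? ? _ ? _];
  [exact: linalgC| |exact: linalgD|exact: linalgM].
by apply: linalg_linform; apply: submx_trans WW'.
Qed.

Lemma linalg_perp W l p : linalg (perp W l) p -> dir_deriv l p = 0.
Proof.
elim=> [c|w|q r _ q0 _ r0|q r _ q0 _ r0]; first exact: dir_derivC.
- by rewrite sub_perp dir_deriv_linform => /andP[_ /eqP->].
- by rewrite dir_derivD q0 r0 addr0.
- by rewrite dir_derivM q0 r0 mul0r mulr0 addr0.
Qed.

Lemma perp_sub W l : (perp W l <= W)%MS.
Proof. exact: capmxSl. Qed.

(** When [dot l z = 1], this substitution sends [linform z] to 0 and fixes every form killed by
    [l]. *)
Definition shear l z : n.-tuple R := [tuple 'X_i - l i *: linform z | i < n].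

Lemma shear_linform l z w :
  linform w \mPo shear l z = linform w - dot l w *: linform z.
Proof.
rewrite {1}/linform raddf_sum /= /dot scaler_suml -sumrB; apply: eq_bigr => i _.
rewrite comp_mpolyZ comp_mpolyXU -tnth_nth tnth_mktuple.
by rewrite scalerBr scalerA.
Qed.

Lemma shear_perp l z W p : linalg (perp W l) p -> p \mPo shear l z = p.
Proof.
elim=> [c|w|q r _ q0 _ r0|q r _ q0 _ r0]; first exact: comp_mpolyC.
- by rewrite sub_perp shear_linform => /andP[_ /eqP->]; rewrite scale0r subr0.
- by rewrite comp_mpolyD q0 r0.
- by rewrite rmorphM /= q0 r0.
Qed.

Lemma decomp_perp W l z w : (z <= W)%MS -> dot l z = 1 -> (w <= W)%MS ->
  (w - dot l w *: z <= perp W l)%MS.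
Proof.
move=> zW lz wW; rewrite sub_perp addmx_sub ?eqmx_opp ?scalemx_sub //=.
rewrite -[X in X == 0]/(\sum_j _) ; under eq_bigr => j _ do rewrite !mxE mulrBl -mulrA.
by rewrite sumrB -mulr_sumr -[X in _ - _ * X]/(dot l z) lz mulr1 subrr.
Qed.

End LinearSubalgebra.

(** * Primes and finiteness *)

Section Ideals.
Variables (K : fieldType) (n : nat).
Local Notation R := {mpoly K[n]}.
Implicit Types (l : 'I_n -> K) (p q : R) (W : 'M[K]_n) (w z : 'rV[K]_n) (I J : R -> Prop).

Definition is_ideal I : Prop :=
  [/\ I 0, forall p q, I p -> I q -> I (p + q) & forall p q, I q -> I (p * q)].

Lemma ideal_sum I (T : Type) (r : seq T) (P : pred T) (F : T -> R) :
  is_ideal I -> (forall t, P t -> I (F t)) -> I (\sum_(t <- r | P t) F t).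
Proof. by case=> I0 ID _ IF; apply: big_ind. Qed.

Lemma is_ideal_mulr I p q : is_ideal I -> I p -> I (p * q).
Proof. by case=> _ _ IM Ip; rewrite mulrC; apply: IM. Qed.

Definition ideal_adjoin I p : R -> Prop := fun q => exists a r, I a /\ q = a + r * p.

Lemma is_ideal_adjoin I p : is_ideal I -> is_ideal (ideal_adjoin I p).
Proof.
case=> I0 ID IM; split; first by exists 0, 0; rewrite mul0r addr0.
- move=> _ _ [a [r [Ia ->]]] [b [s [Ib ->]]]; exists (a + b), (r + s).
  by split; [apply: ID | ring].
- move=> q _ [a [r [Ia ->]]]; exists (q * a), (q * r).
  by split; [apply: IM | ring].
Qed.

Lemma ideal_adjoin_sub I p q : I q -> ideal_adjoin I p q.
Proof. by move=> Iq; exists q, 0; rewrite mul0r addr0. Qed.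

Lemma ideal_adjoin_mem I p : is_ideal I -> ideal_adjoin I p p.
Proof. by case=> I0 _ _; exists 0, 1; rewrite mul1r add0r. Qed.

(** Zorn gives [P] maximal among the ideals over [I] avoiding [S]. For [p] and [q] outside [P],
    adjoining either one produces an element of [S]; if [p * q] were in [P], the product of these
    two elements would be in both [P] and [S]. *)
Lemma exists_prime_avoiding I (S : R -> Prop) : is_ideal I ->
  S 1 -> (forall p q, S p -> S q -> S (p * q)) -> (forall p, I p -> ~ S p) ->
  exists P, [/\ prime_ideal P, forall p, I p -> P p & forall p, P p -> ~ S p].
Proof.
move=> idI S1 SM IS; have [I0 _ _] := idI.
pose good J := [/\ is_ideal J, forall p, I p -> J p & forall p, J p -> ~ S p].
have [|P [Pgood Pmax]] :=
    @classical_sets.Zorn_bigcup R (fun J => (forall p, ~ J p) \/ good J).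
  move=> F FP Ftot.
  have [[J [FJ gJ]]|nF] := boolp.pselect (exists J, F J /\ good J); last first.
    left=> p [J FJ Jp]; case: (FP _ FJ) => [/(_ p)//|gJ].
    by apply: nF; exists J.
  have [[J0 JD JM] IJ JS] := gJ; right; split.
  - split; first by exists J.
    + move=> p q [A FA Ap] [B FB Bq].
      wlog AB : A B p q FA Ap FB Bq / classical_sets.subset A B.
        move=> H; case: (Ftot A B FA FB) => AB; first exact: (H A B).
        by rewrite addrC; apply: (H B A).
      case: (FP _ FB) => [/(_ q)//|[[_ BD _] _ _]].
      by exists B => //; apply: BD => //; apply: AB.
    + move=> p q [A FA Aq]; case: (FP _ FA) => [/(_ q)//|[[_ _ AM] _ _]].
      by exists A => //; apply: AM.
  - by move=> p /IJ Jp; exists J.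
  - move=> p [A FA Ap]; case: (FP _ FA) => [/(_ p)//|[_ _ AS]].
    exact: AS.
have gI : good I by split.
case: Pgood => [P0|gP].
  case: (Pmax I); last by right.
  by split=> [p /P0//|IP]; apply: (P0 0); apply: IP.
have [idP IP PS] := gP; have [PZ PD PM] := idP.
have meetS p : ~ P p -> exists s, ideal_adjoin P p s /\ S s.
  move=> nPp; apply: boolp.contrapT => nS; apply: (Pmax (ideal_adjoin P p)).
    split=> [q|sub]; first exact: ideal_adjoin_sub.
    by apply/nPp/sub/ideal_adjoin_mem.
  right; split; first exact: is_ideal_adjoin.
    by move=> q /IP; apply: ideal_adjoin_sub.
  by move=> q Pq Sq; apply: nS; exists q.
exists P; split=> //; split=> // [P1|p q Ppq]; first exact: PS P1 S1.
have [Pp|/meetS[_ [[a [r [Pa ->]]] Ss]]] := boolp.pselect (P p); [by left|right].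
apply: boolp.contrapT => /meetS[_ [[b [t [Pb ->]]] St]].
apply: (PS _ _ (SM _ _ Ss St)).
have -> : (a + r * p) * (b + t * q) = (b + t * q) * a + ((r * p) * b + (r * t) * (p * q)).
  by ring.
by apply: (PD); [|apply: PD]; apply: PM.
Qed.

(** R/I is a finite module over K[W], expressed through representatives in R. *)
Definition finite_over I W : Prop := exists (T : finType) (b : T -> R),
  forall r, exists a : T -> R,
    (forall t, linalg W (a t)) /\ I (r - \sum_t a t * b t).

Lemma finite_over1 I : is_ideal I -> finite_over I 1%:M.
Proof.
case=> I0 _ _; exists unit, (fun=> 1) => r; exists (fun=> r).
by split=> [_|]; [apply: linalgT | rewrite (big_pred1 tt) ?mulr1 ?subrr // => -[]].
Qed.

Lemma finite_over_sub I J W : (forall p, I p -> J p) ->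
  finite_over I W -> finite_over J W.
Proof.
move=> IJ [T [b fb]]; exists T, b => r.
by have [a [Wa /IJ]] := fb r; exists a.
Qed.

(* Cayley-Hamilton for multiplication by [r] on the finite module, followed by
   the specialisation of [linform z] to 0. *)
Lemma linalg_perp_adjoin I W l z a r : is_ideal I -> finite_over I W ->
  (forall p, I p -> linalg W p -> p = 0) -> (z <= W)%MS -> dot l z = 1 ->
  linalg (perp W l) a -> I (a - r * linform z) -> a = 0.
Proof.
move=> idI [T [b fb]] I0 zW lz Wa Iarz; have [IZ ID IM] := idI.
set Z := linform z in Iarz *; pose N := #|T|; pose c (i : 'I_N) := b (enum_val i).
have fc s : exists u : 'I_N -> R, (forall i, linalg W (u i)) /\
    I (s - \sum_i u i * c i).
  have [u [Wu Iu]] := fb s; exists (fun i => u (enum_val i)); split=> // .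
  move: Iu; congr (I (s - _)).
  rewrite (reindex (@enum_val T T)) //=.
  by apply: onW_bij; apply: enum_val_bij.
have [m mP] := fin_all_exists (fun i => fc (r * c i)).
(* As [r * c i] is [\sum_j m i j * c j] modulo [I], the matrix [A] acts on the generators as
   [a - r * Z], an element of [I]. *)
pose A : 'M[R]_N := a%:M - Z *: \matrix_(i, j) m i j.
have WZ : linalg W Z by apply: linalg_linform.
have WA i j : linalg W (A i j).
  rewrite !mxE; apply: linalgD.
    case: (i == j); rewrite ?mulr1n ?mulr0n; last exact: linalg0.
    by apply: linalg_sub Wa; apply: perp_sub.
  by apply: linalgN; apply: linalgM => //; case: (mP i).
have IAc i : I (\sum_j A i j * c j).
  have -> : \sum_j A i j * c j = c i * (a - r * Z) + Z * (r * c i - \sum_j m i j * c j).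
    have -> : \sum_j A i j * c j = a * c i - Z * \sum_j m i j * c j.
      rewrite mulr_sumr; under eq_bigr => j _ do rewrite !mxE mulrBl -[X in _ - X]mulrA.
      rewrite sumrB; congr (_ - _); rewrite (bigD1 i) //= eqxx mulr1n big1 ?addr0 // => j ji.
      by rewrite eq_sym (negPf ji) mulr0n mul0r.
    by ring.
  by apply: ID; apply: IM => //; case: (mP i).
have Idc i : I (\det A * c i).
  have -> : \det A * c i = \sum_j \adj A i j * \sum_k A j k * c k.
    under eq_bigr => j _ do rewrite mulr_sumr.
    rewrite exchange_big /= (bigD1 i) //= [X in _ = _ + X]big1 ?addr0 => [|k ki].
      under eq_bigr => j _ do rewrite mulrA.
      rewrite -mulr_suml; congr (_ * _); have := mul_adj_mx A.
      by move/matrixP/(_ i i); rewrite !mxE eqxx mulr1n.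
    under eq_bigr => j _ do rewrite mulrA.
    rewrite -mulr_suml; have := mul_adj_mx A.
    by move/matrixP/(_ i k); rewrite !mxE eq_sym (negPf ki) mulr0n => ->; rewrite mul0r.
  by apply: ideal_sum => // j _; apply: IM.
(* The determinant kills every generator modulo [I], hence also 1, so it lies in both [I] and K[W],
   which meet in 0. *)
have det0 : \det A = 0.
  apply: I0; last exact: linalg_det.
  have [u [_ Iu]] := fc 1.
  have -> : \det A = \det A * (1 - \sum_i u i * c i) + \sum_i u i * (\det A * c i).
    have -> : \sum_i u i * (\det A * c i) = \det A * \sum_i u i * c i.
      by rewrite mulr_sumr; apply: eq_bigr => i _; ring.
    by ring.
  by apply: ID; [apply: IM | apply: ideal_sum => // i _; apply: IM].
(* Setting [Z] to 0 turns [A] into the scalar matrix [a], whose determinant is a power of [a]. *)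
pose phi : {rmorphism R -> R} := comp_mpoly (shear l z).
have : phi (\det A) = a ^+ N.
  rewrite -det_map_mx -det_scalar; congr (\det _).
  apply/matrixP => i j; rewrite !mxE rmorphB rmorphM rmorphMn /= (shear_perp _ Wa).
  by rewrite shear_linform lz scale1r subrr mul0r subr0.
by rewrite det0 rmorph0 => /esym/eqP; rewrite expf_eq0 => /andP[_ /eqP].
Qed.

End Ideals.

(** * Noether normalisation and chains of primes *)

Section Noether.
Variables (K : fieldType) (n : nat).
Hypothesis K0 : [pchar K] =i pred0.
Local Notation R := {mpoly K[n]}.
Implicit Types (p q : R) (I J : R -> Prop).

Section Slice.
Variables (W : 'M[K]_n) (l : 'I_n -> K) (z : 'rV[K]_n).
Hypotheses (zW : (z <= W)%MS) (lz : dot l z = 1).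
Local Notation Z := (linform z).
Local Notation A' := (linalg (perp W l)).

Lemma linalg_slice p : linalg W p ->
  exists q : {poly R}, (forall i, A' q`_i) /\ p = q.[Z].
Proof.
elim=> [c|w wW|_ _ _ [q [Wq ->]] _ [r [Wr ->]]|_ _ _ [q [Wq ->]] _ [r [Wr ->]]].
- exists (c%:MP)%:P; split=> [i|]; last by rewrite hornerC.
  by rewrite coefC; case: eqP => _; [apply: linalgC | apply: linalg0].
- exists ((linform (w - dot l w *: z))%:P + (dot l w)%:MP *: 'X); split=> [i|].
    rewrite coefD coefZ coefC coefX; apply: linalgD.
      by case: eqP => _; [apply/linalg_linform/decomp_perp | apply: linalg0].
    apply: linalgM; first exact: linalgC.
    by case: eqP => _; [apply: linalg1 | apply: linalg0].
  by rewrite !hornerE -scaleNr linformD linformZ mul_mpolyC scaleNr subrK.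
- exists (q + r); rewrite hornerD; split=> // i.
  by rewrite coefD; apply: linalgD.
- exists (q * r); rewrite hornerM; split=> // i.
  by rewrite coefM; apply: linalg_sum => j _; apply: linalgM.
Qed.

Lemma linalg_deriv (q : {poly R}) : (forall i, A' q`_i) -> forall i, A' q^`()`_i.
Proof.
by move=> Aq i; rewrite coef_deriv -scaler_nat; apply: linalgZ.
Qed.

(** Along [l] the coefficients are constants and [Z] has derivative 1. *)
Lemma dir_deriv_slice (q : {poly R}) : (forall i, A' q`_i) ->
  dir_deriv l q.[Z] = q^`().[Z].
Proof.
elim/poly_ind: q => [|q c IH] Aq.
  by rewrite deriv0 horner0 -mpolyC0 dir_derivC.
rewrite derivMXaddC hornerMXaddC hornerD hornerMX dir_derivD dir_derivM.
rewrite dir_deriv_linform lz mpolyC1 mulr1 IH => [|i]; last first.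
  by have := Aq i.+1; rewrite coefD coefMX coefC /= addr0.
have := Aq 0%N; rewrite coefD coefMX coefC /= add0r => /linalg_perp ->.
by rewrite addr0 addrC.
Qed.

(** The derivative of a relation for [Z] over K[perp W l] is a relation of smaller size, so zero by
    induction; characteristic zero then makes the relation constant. *)
Lemma slice_inj (q : {poly R}) : (forall i, A' q`_i) -> q.[Z] = 0 -> q = 0.
Proof.
have [k] := ubnP (size q); elim: k q => // k IH q; rewrite ltnS => qk Aq qZ.
have q'0 : q^`() = 0.
  have [->|qn0] := eqVneq q 0; first exact: deriv0.
  apply: IH; last by rewrite -dir_deriv_slice // qZ -mpolyC0 dir_derivC.
    exact: leq_trans (lt_size_deriv qn0) qk.
  exact: linalg_deriv.
have qC : q = (q`_0)%:P.
  apply/polyP => -[|i]; rewrite coefC //=.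
  have /eqP := coef_deriv q i; rewrite q'0 coef0 eq_sym -scaler_nat scaler_eq0.
  by rewrite (negPf (pchar0_natrS_neq0 K0 i)) => /eqP.
by move: qZ; rewrite qC hornerC => ->; rewrite polyC0.
Qed.

(** Write [f] as a polynomial in [Z]. Its [d]-th formal derivative is the constant [d! c]; dividing
    by nonzero falling factorials leaves coefficient [c] in degree [d] and none above. *)
Lemma monic_relation f d c : linalg W f -> dir_lead l f d c ->
  exists a : nat -> R, (forall i, A' (a i)) /\
    f = c *: Z ^+ d + \sum_(i < d) a i * Z ^+ i.
Proof.
move=> /linalg_slice[q [Aq ->]]; rewrite /dir_lead.
have -> : iter d (dir_deriv l) q.[Z] = q^`(d).[Z].
  elim: d => [|d IHd]; first by rewrite derivn0.
  rewrite iterS IHd derivnS dir_deriv_slice // => i.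
  by rewrite coef_derivn -scaler_nat; apply: linalgZ.
move=> qd; have {}qd : q^`(d) = ((d`!%:R * c)%:MP)%:P.
  apply/eqP; rewrite -subr_eq0; apply/eqP; apply: slice_inj => [i|].
    rewrite coefB coef_derivn coefC -scaler_nat; apply: linalgD; first exact: linalgZ.
    by case: eqP => _; apply: linalgN; [apply: linalgC | apply: linalg0].
  by rewrite hornerD hornerN qd hornerC subrr.
have ffact_neq0 j : (((d + j) ^_ d)%:R : K) != 0.
  by rewrite -(prednK (n := (d + j) ^_ d)) ?(pchar0_natrS_neq0 K0) // ffact_gt0 leq_addr.
have q_d : q`_d = c%:MP.
  have := coef_derivn d q 0; rewrite qd coefC /= addn0 ffactnn -scaler_nat.
  rewrite mpolyCM mul_mpolyC => /eqP; have := ffact_neq0 0%N.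
  rewrite addn0 ffactnn => d0; rewrite -subr_eq0 -scalerBr scaler_eq0 (negPf d0) /=.
  by rewrite subr_eq0 => /eqP.
have q_gt i : (d < i)%N -> q`_i = 0.
  case: i => // i; rewrite ltnS => di.
  have := coef_derivn d q (i.+1 - d); rewrite qd coefC subSn //= -subSn // subnKC 1?leqW //.
  rewrite -scaler_nat => /esym/eqP; rewrite scaler_eq0.
  have := ffact_neq0 (i.+1 - d)%N; rewrite subnKC 1?leqW // => /negPf->.
  by move/eqP.
exists (fun i => q`_i); split=> //; rewrite (@horner_coef_wide _ d.+1); last first.
  by apply/leq_sizeP => i; apply: q_gt.
by rewrite big_ord_recr /= q_d addrC mul_mpolyC.
Qed.

(** Dividing by [c] makes [f] monic in [Z], so modulo [I] the powers of [Z] below [d] span K[W] over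
    K[perp W l]. Their products with the [b t] then generate R/I. *)
Lemma finite_over_perp I f d c : is_ideal I -> finite_over I W -> I f ->
  linalg W f -> dir_lead l f d c -> c != 0 -> finite_over I (perp W l).
Proof.
move=> idI [T [b fb]] If Wf fd c0; have [IZ ID IM] := idI.
have [h [g [Ih Ag hE]]] : exists (h : R) (g : nat -> R), [/\ I h, forall i, A' (g i) &
    h = Z ^+ d + \sum_(i < d) g i * Z ^+ i].
  have [g [Ag fE]] := monic_relation Wf fd.
  exists (c^-1%:MP * f), (fun i => c^-1 *: g i); split=> [|i|]; first exact: IM.
    exact: linalgZ.
  rewrite mul_mpolyC fE scalerDr scalerA mulVf // scale1r scaler_sumr.
  by congr (_ + _); apply: eq_bigr => i _; rewrite scalerAl.
pose S p := exists a : nat -> R,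
  (forall i, A' (a i)) /\ I (p - \sum_(i < d) a i * Z ^+ i).
have SD p q : S p -> S q -> S (p + q).
  move=> [a [Aa Ia]] [a' [Aa' Ia']]; exists (fun i => a i + a' i).
  split=> [i|]; first exact: linalgD.
  under eq_bigr => i _ do rewrite mulrDl.
  by rewrite big_split opprD addrACA; apply: ID.
have SA p q : A' p -> S q -> S (p * q).
  move=> Ap [a [Aa Ia]]; exists (fun i => p * a i).
  split=> [i|]; first exact: linalgM.
  under eq_bigr => i _ do rewrite -mulrA.
  by rewrite -mulr_sumr -mulrBr; apply: IM.
have SZ q : S q -> S (Z * q).
  (* When [d = 0] the relation says that [h = 1] lies in [I], so the empty sum suffices. *)
  move=> [a [Aa Ia]]; move: hE Ia {SD SA fd} @S; case: d => [|d] hE Ia S.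
    exists (fun=> 0); split=> [i|]; first exact: linalg0.
    have -> : Z * q - \sum_(i < 0) 0 * Z ^+ i = (Z * q) * h.
      by rewrite hE !big_ord0; ring.
    exact: IM.
  (* Multiplication by [Z] shifts the coefficients; the overflowing term [a d * Z ^+ d.+1] is
     rewritten by means of [h]. *)
  pose s i := if i is j.+1 then a j else 0.
  exists (fun i => s i - a d * g i); split=> [i|].
    apply: linalgD; first by case: i => [|i] /=; [apply: linalg0|].
    by apply: linalgN; apply: linalgM.
  have -> : Z * q - \sum_(i < d.+1) (s i - a d * g i) * Z ^+ i =
      Z * (q - \sum_(i < d.+1) a i * Z ^+ i) + a d * h.
    under eq_bigr => i _ do rewrite mulrBl -mulrA.
    rewrite hE sumrB -mulr_sumr big_ord_recl /=.
    rewrite [\sum_(i < d.+1) a i * _]big_ord_recr /=.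
    have -> : \sum_(i < d) a i * Z ^+ bump 0 i = Z * \sum_(i < d) a i * Z ^+ i.
      by rewrite mulr_sumr; apply: eq_bigr => i _; rewrite /bump /= exprS; ring.
    by rewrite exprS; ring.
  by apply: ID; apply: IM.
have SM p q : linalg W p -> S q -> S (p * q).
  move=> Wp; elim: Wp q => [e|w wW|p1 p2 _ S1 _ S2|p1 p2 _ S1 _ S2] q Sq.
  - by apply: SA => //; apply: linalgC.
  - rewrite -[w](subrK (dot l w *: z)) linformD linformZ mulrDl -scalerAl -mul_mpolyC.
    apply: (SD); first by apply: SA => //; apply/linalg_linform/decomp_perp.
    by apply: SA; [apply: linalgC | apply: SZ].
  - by rewrite mulrDl; apply: SD; [apply: S1 | apply: S2].
  - by rewrite -mulrA; apply/S1/S2.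
have S1 : S 1.
  move: hE {SD SA SZ SM fd} @S; case: d => [|d] hE S.
    exists (fun=> 0); split=> [i|]; first exact: linalg0.
    have -> : 1 - \sum_(i < 0) 0 * Z ^+ i = h by rewrite hE !big_ord0; ring.
    by [].
  exists (fun i => (i == 0%N)%:R); split=> [[|i]|]; [exact: linalg1|exact: linalg0|].
  by rewrite big_ord_recl big1 ?addr0 ?mulr1 ?subrr // => i _; rewrite mul0r.
exists (T * 'I_d)%type, (fun ti : T * 'I_d => Z ^+ ti.2 * b ti.1) => r.
have [a [Wa Ia]] := fb r.
have Sa t : S (a t) by rewrite -[a t]mulr1; apply: SM.
have [a' a'P] := fin_all_exists Sa.
exists (fun ti : T * 'I_d => a' ti.1 ti.2); split=> [[t i]|]; first by case: (a'P t).
have -> : \sum_(ti : T * 'I_d) a' ti.1 ti.2 * (Z ^+ ti.2 * b ti.1) =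
    \sum_t (\sum_(i < d) a' t i * Z ^+ i) * b t.
  under [RHS]eq_bigr => t _ do rewrite mulr_suml.
  by rewrite pair_bigA; apply: eq_bigr => -[t i] _ /=; rewrite mulrA.
have -> : forall x, r - x = (r - \sum_t a t * b t) + (\sum_t a t * b t - x).
  by move=> x; rewrite addrA subrK.
apply: ID => //; rewrite -sumrB; apply: ideal_sum => // t _.
by rewrite -mulrBl; apply: is_ideal_mulr => //; case: (a'P t).
Qed.

End Slice.

Lemma exists_dual (W : 'M[K]_n) l z : (z <= W)%MS -> dot l z != 0 ->
  exists z', (z' <= W)%MS /\ dot l z' = 1.
Proof.
move=> zW lz; exists ((dot l z)^-1 *: z); rewrite scalemx_sub //; split=> //.
rewrite -(mulVf lz) [RHS]mulr_sumr; apply: eq_bigr => j _.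
by rewrite mxE mulrA.
Qed.

(** The chain starts at a prime [P] over [I] meeting K[W] in 0. Adjoining a form [Z] of [W] gives an
    ideal meeting K[perp W l] in 0 by [linalg_perp_adjoin], with quotient finite over it; induction
    continues there, the rank having dropped by at most one. *)
Lemma exists_prime_chain e I (W : 'M[K]_n) : is_ideal I -> finite_over I W ->
  (forall p, I p -> linalg W p -> p = 0) -> (e <= \rank W)%N ->
  exists c : nat -> R -> Prop,
    (forall j, (j <= e)%N -> prime_ideal (c j) /\ forall p, I p -> c j p) /\
    (forall j, (j < e)%N -> (forall p, c j p -> c j.+1 p) /\
                            exists p, c j.+1 p /\ ~ c j p).
Proof.
elim: e I W => [|e IH] I W idI finI IW eW.
all: have [|||P [prP IP PW]] := @exists_prime_avoiding K n I
  (fun p => linalg W p /\ p <> 0) idI.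
all: try by [split; [apply: linalg1 | apply/eqP/oner_neq0]
  | move=> p q [Wp /eqP p0] [Wq /eqP q0]; split; [apply: linalgM | apply/eqP/mulf_neq0]
  | move=> p Ip [Wp p0]; apply: p0; apply: IW].
  by exists (fun=> P); split.
have idP : is_ideal P by case: prP.
have {}PW p : P p -> linalg W p -> p = 0.
  by move=> Pp Wp; apply: boolp.contrapT => p0; apply: (PW p).
have [l [z [zW lz]]] : exists l z, (z <= W)%MS /\ dot l z = 1.
  have [z zW z0] : exists2 z : 'rV[K]_n, (z <= W)%MS & z != 0.
    have : W != 0 by rewrite -mxrank_eq0 -lt0n (leq_trans _ eW).
    by case/rowV0Pn => z zW z0; exists z.
  have [j zj] : exists j, z 0 j != 0 by apply/rV0Pn.
  exists (fun i => (i == j)%:R); apply: (@exists_dual W _ z) => //.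
  rewrite /dot (bigD1 j) //= eqxx mulr1 big1 ?addr0 // => i ij.
  by rewrite (negPf ij) mulr0.
pose J := ideal_adjoin P (linform z).
have idJ : is_ideal J by apply: is_ideal_adjoin.
have PJ p : P p -> J p by apply: ideal_adjoin_sub.
have finP : finite_over P W by apply: finite_over_sub finI.
have Jz : J (linform z) by apply: ideal_adjoin_mem.
have Wz : linalg W (linform z) by apply: linalg_linform.
have finJ : finite_over J (perp W l).
  apply: (finite_over_perp zW lz idJ (finite_over_sub PJ finP) Jz Wz
            (d := 1) (c := 1)); last exact: oner_neq0.
  by rewrite /dir_lead /= dir_deriv_linform lz mul1r.
have JW p : J p -> linalg (perp W l) p -> p = 0.
  move=> [a [r [Pa pE]]] Wp.
  apply: (linalg_perp_adjoin idP finP PW zW lz Wp (r := r)).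
  by rewrite pE addrK.
have eW' : (e <= \rank (perp W l))%N.
  by rewrite -ltnS (leq_trans eW) // rank_perp.
have [c [cP cS]] := IH _ _ idJ finJ JW eW'.
exists (fun j => if j is i.+1 then c i else P); split=> [[|j] je|[|j] je].
- by [].
- by have [? Jc] := cP j je; split=> // p /IP/PJ/Jc.
- have [_ Jc] := cP 0%N (leq0n _); split=> [p /PJ/Jc //|].
  exists (linform z); split; first exact: Jc.
  (* If [Z] were in [P] it would be 0, yet its derivative along [l] is 1. *)
  move/PW => /(_ Wz) z0; have := dir_deriv_linform l z.
  by rewrite z0 lz -mpolyC0 dir_derivC => /esym/eqP; rewrite mpolyC_eq0 oner_eq0.
- exact: cS.
Qed.

End Noether.

(** * Regular sequences on a finitely generated Weyl module *)

Section WeylModule.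
Variables (K : fieldType) (n : nat) (M : lmodType K).
Variables X D : 'I_n -> {linear M -> M}.
Hypothesis K0 : [pchar K] =i pred0.
Hypothesis hW : weyl_module X D.
Local Notation R := {mpoly K[n]}.
Implicit Types (l : 'I_n -> K) (p q f : R) (N : M -> Prop).

Let XC i j m : X i (X j m) = X j (X i m). Proof. by case: hW. Qed.
Let DC i j m : D i (D j m) = D j (D i m). Proof. by case: hW. Qed.
Let DX i j m : D i (X j m) - X j (D i m) = (i == j)%:R *: m. Proof. by case: hW. Qed.

(** Makes the elements killed by a power of [f] stable under each [D i], at the cost of one more
    power. *)
Lemma mderiv_exp i f k : exists q, mderiv i (f ^+ k.+1) = q * f ^+ k.
Proof.
elim: k => [|k [q IH]]; first by exists (mderiv i f); rewrite mulr1.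
by exists (mderiv i f + q); rewrite exprS mderivM IH exprS; ring.
Qed.

Lemma linalg_dir_deriv (W : 'M[K]_n) l p : linalg W p -> linalg W (dir_deriv l p).
Proof.
elim=> [c|w _|q r _ Wq _ Wr|q r Wq Wq' Wr Wr'].
- by rewrite dir_derivC; apply: linalg0.
- by rewrite dir_deriv_linform; apply: linalgC.
- by rewrite dir_derivD; apply: linalgD.
- by rewrite dir_derivM; apply: linalgD; apply: linalgM.
Qed.

Lemma Xmon_closed (P : M -> Prop) (Y : 'I_n -> {linear M -> M}) a m :
  (forall i m, P m -> P (Y i m)) -> P m -> P (Xmon Y a m).
Proof.
move=> PY Pm; rewrite /Xmon; elim: (enum _) => //= i s IH.
by elim: (a i) => //= k; apply: PY.
Qed.

Lemma dirD_closed N l m : submodule N -> D_stable D N -> N m -> N (dirD D l m).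
Proof.
move=> sN dN Nm; apply: submodule_sum => // j _.
by case: (sN) => _ _; apply; apply: dN.
Qed.

(** Commuting [dirD l] past a polynomial differentiates it along [l], so all iterated derivatives of
    [f ^+ k] send [m] into [N]; the one of order [d * k] is the nonzero constant [(d k)! c^k]. *)
Lemma dirD_injective_mod N (W : 'M[K]_n) l f d c : submodule N -> D_stable D N ->
  (forall p m, linalg W p -> N m -> N (polact X p m)) ->
  linalg W f -> dir_lead l f d c -> c != 0 ->
  (forall m, exists k, polact X (f ^+ k) m = 0) ->
  forall m, N (dirD D l m) -> N m.
Proof.
move=> sN dN WN Wf fd c0 nil m Nm; have [N0 ND NZ] := sN.
have [k fk] := nil m; have Wfk : linalg W (f ^+ k).
  by elim: {fk} k => [|k IH]; [apply: linalg1 | rewrite exprS; apply: linalgM].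
have iterN e : linalg W (iter e (dir_deriv l) (f ^+ k)) /\
    N (polact X (iter e (dir_deriv l) (f ^+ k)) m).
  elim: e => [|e [We Ne]] /=; first by rewrite fk.
  split; first exact: linalg_dir_deriv.
  set g := iter e _ _ in We Ne *.
  have -> : polact X (dir_deriv l g) m =
      - polact X g (dirD D l m) + dirD D l (polact X g m).
    by rewrite (dirD_polact XC DX) addKr.
  apply: ND; last exact: dirD_closed.
  by apply: submoduleN => //; apply: WN.
have [_] := iterN (d * k)%N; rewrite (dir_leadXn k fd) polactC // => Ncm.
have s0 : (d * k)`!%:R * c ^+ k != 0.
  rewrite mulf_neq0 ?expf_neq0 // -(prednK (fact_gt0 _)).
  exact: pchar0_natrS_neq0.
by have := NZ ((d * k)`!%:R * c ^+ k)^-1 _ Ncm; rewrite scalerA mulVf // scale1r.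
Qed.

(** Polynomials in K[perp W l] have zero derivative along [l], hence commute with [dirD l]. This is
    why the acting algebra shrinks with each new direction. *)
Lemma polact_stable_add_image N (W : 'M[K]_n) l :
  (forall p m, linalg W p -> N m -> N (polact X p m)) ->
  forall p m, linalg (perp W l) p -> add_image D l N m ->
    add_image D l N (polact X p m).
Proof.
move=> WN p _ Wp [a [z [Na ->]]]; exists (polact X p a), (polact X p z).
split; first by apply: WN => //; apply: linalg_sub Wp; apply: perp_sub.
by rewrite (dirD_polact XC DX) (linalg_perp Wp) polact0 addr0 polactDr.
Qed.

Variables (r : nat) (v : 'I_r -> M).
Hypothesis gen : forall m : M,
  exists s : seq (('X_{1..n} * 'X_{1..n}) * ('I_r * K)),
    m = \sum_(t <- s) t.2.2 *: Xmon X t.1.1 (Xmon D t.1.2 (v t.2.1)).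

(** The ideal [I] of the overview; the [v j] generate M over the Weyl algebra, not over R. *)
Definition ann_gen p : Prop := forall j, polact X p (v j) = 0.

Lemma is_ideal_ann_gen : is_ideal ann_gen.
Proof.
split=> [j|p q Ip Iq j|p q Iq j]; first exact: polact0.
  by rewrite polactD Ip Iq addr0.
by rewrite polactM // Iq polact0r.
Qed.

(** Otherwise each [v j] is killed by some [s j] outside [P]; the product of the [s j] lies in the
    annihilator, hence in [P], against primality. *)
Lemma in_support_prime P : prime_ideal P -> (forall p, ann_gen p -> P p) ->
  in_support X P.
Proof.
move=> [_ _ _ P1 PM] IP; apply: boolp.contrapT => nsupp.
have sP j : exists s, ~ P s /\ polact X s (v j) = 0.
  apply: boolp.contrapT => ns; apply: nsupp; exists (v j) => s Ps sv.
  by apply: ns; exists s.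
have [s {}sP] := fin_all_exists sP.
suff : P (\prod_j s j).
  apply: (big_ind (fun p => ~ P p)) => // [p q nPp nPq /PM[]//|j _].
  by case: (sP j).
apply: IP => j; rewrite (bigD1 j) //= mulrC polactM //.
by case: (sP j) => _ ->; rewrite polact0r.
Qed.

(** The elements killed by a power of [f] form a subspace stable under [X] and [D] and containing
    the [v j]. *)
Lemma ann_gen_nilpotent f : ann_gen f -> forall m, exists k, polact X (f ^+ k) m = 0.
Proof.
move=> If m; have [s ->] := gen m.
pose S m := exists k, polact X (f ^+ k) m = 0; rewrite -/(S _).
apply: big_ind => [|x y [k fx] [k' fy]|t _].
- by exists 0%N; rewrite polact0r.
- exists (k + k')%N; rewrite polactDr {1}addnC !exprD !polactM // fx fy.
  by rewrite !polact0r addr0.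
have SX i x : S x -> S (X i x).
  move=> [k fx]; exists k.
  by rewrite -polactXU -polactM // mulrC polactM // fx polact0r.
have SD i x : S x -> S (D i x).
  move=> [k fx]; exists k.+1; have [q fq] := mderiv_exp i f k.
  have := D_polact XC DX i (f ^+ k.+1) x.
  by rewrite fq polactM // fx polact0r addr0 exprS polactM // fx polact0r linear0.
have [k kP] : S (Xmon X t.1.1 (Xmon D t.1.2 (v t.2.1))).
  by do 2![apply: Xmon_closed => //]; exists 1%N; apply: If.
by exists k; rewrite polactZr kP scaler0.
Qed.

(** Each step uses one direction and at most one unit of the rank of [W]. If the annihilator met
    K[W] in 0, the support would contain a chain of length [\rank W], so [\rank W + i < n], against
    the rank bound; hence the [f] required by [dirD_injective_mod] exists. *)
Lemma regular_stable i s (W : 'M[K]_n) N : supp_dim_plus_lt X i -> ~ ann_gen 1 ->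
  submodule N -> D_stable D N ->
  (forall p m, linalg W p -> N m -> N (polact X p m)) ->
  finite_over ann_gen W -> (n + s <= \rank W + i.+1)%N -> regular D s N.
Proof.
move=> hdim I1; elim: s W N => //= s IH W N sN dN WN finW rW.
have idI := is_ideal_ann_gen; have [_ _ IM] := idI.
have [f [If [Wf f0]]] : exists f, ann_gen f /\ linalg W f /\ f != 0.
  apply: boolp.contrapT => nf.
  have IW p : ann_gen p -> linalg W p -> p = 0.
    by move=> Ip Wp; apply/eqP/negPn/negP => p0; apply: nf; exists p.
  have [c [cP cS]] := exists_prime_chain K0 idI finW IW (leqnn _).
  have /hdim : support_chain X (\rank W) c.
    split=> [j /cP[cprime Ic]|]; last exact: cS.
    by split=> //; apply: in_support_prime.
  by rewrite ltnNge (leq_trans (leq_addr s n)) // -ltnS -!addnS.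
have [l [d [c [c0 fd]]]] := exists_dir_lead K0 f0.
have [z [zW lz]] : exists z, (z <= W)%MS /\ dot l z = 1.
  (* If [l] vanished on [W], then [f] would have zero derivative along [l], forcing [d = 0] and
     [f = c], a nonzero constant in the annihilator. *)
  apply: boolp.contrapT => nz; apply: I1.
  have Wl w : (w <= W)%MS -> dot l w = 0.
    move=> wW; apply/eqP/negPn/negP => lw; apply: nz.
    exact: exists_dual wW lw.
  have WW : (W <= perp W l)%MS.
    by apply/rV_subP => w wW; rewrite sub_perp wW Wl ?eqxx.
  have lf := linalg_perp (linalg_sub WW Wf).
  move: fd; rewrite /dir_lead; case: d => [|d].
    rewrite /= mul1r => fC; have -> : 1 = c^-1%:MP * f.
      by rewrite fC -mpolyCM mulVf // mpolyC1.
    exact: IM.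
  rewrite iterSr lf iter_dir_deriv0 => /esym/eqP.
  rewrite mpolyC_eq0 mulf_eq0 (negPf c0) orbF -(prednK (fact_gt0 _)).
  by rewrite (negPf (pchar0_natrS_neq0 K0 _)).
exists l; split.
  exact: (dirD_injective_mod sN dN WN Wf fd c0 (ann_gen_nilpotent If)).
apply: (IH (perp W l)).
- exact: submodule_add_image.
- exact: D_stable_add_image.
- exact: polact_stable_add_image.
- exact: (finite_over_perp K0 zW lz idI finW If Wf fd c0).
- rewrite -ltnS -addnS (leq_trans rW) // -addSn leq_add2r.
  exact: rank_perp.
Qed.

Lemma deRham_vanish_of_generators i : supp_dim_plus_lt X i -> deRham_vanish D i.
Proof.
move=> hdim w dw; have [I1|I1] := boolp.pselect (ann_gen 1).
  have M0 (m m' : M) : m = m'.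
    have H (x : M) : x = 0.
      have [k] := ann_gen_nilpotent I1 x.
      by rewrite expr1n -mpolyC1 polactC // scale1r.
    by rewrite (H m) (H m').
  by exists w => T _; apply: M0.
have sN : submodule (fun m : M => m = 0).
  by split=> // [a b -> ->|c a ->]; rewrite ?addr0 ?scaler0.
have dN : D_stable D (fun m : M => m = 0) by move=> j m ->; rewrite linear0.
have two0 : (2 : K) != 0 by apply: pchar0_natrS_neq0.
have [|u uP] := regular_deRham two0 DC sN dN _ dw; last first.
  by exists u => T /uP/eqP; rewrite subr_eq0 => /eqP.
(* Start from [N = 0], all linear forms and [i.+1] directions; the rank bound is then an
   equality. *)
apply: (regular_stable (W := 1%:M) (i := i)) => //.
- by move=> p m _ ->; rewrite polact0r.
- by apply/finite_over1/is_ideal_ann_gen.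
- by rewrite mxrank1.
Qed.

End WeylModule.

Theorem theorem3 (K : fieldType) (hK : [pchar K] =i pred0) (n : nat)
  (M : lmodType K) (X D : 'I_n -> {linear M -> M})
  (hW : weyl_module X D) (hH : holonomic X D) :
  forall i : nat, supp_dim_plus_lt X i -> deRham_vanish D i.
Proof.
have [r [v [_ [gen _]]]] := hH.
move=> i; exact: (deRham_vanish_of_generators hK hW gen).
Qed.
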